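(* Let $\lambda>0$ and let $\beta_n(t)$, $t\in\mathbb{R}$, $n=0,1,2,\ldots$, be the off-diagonal recurrence coefficient of the monic orthogonal polynomials with respect to $w(x;t)=x^\lambda e^{-x^2+tx}$ on $(0,\infty)$. Then $\beta_n=\beta_n(t)$ satisfies the second-order differential equation (with $'=d/dt$) $$\left[2\beta_n''+12\beta_n^2-4(2n+\lambda)\beta_n+n(n+\lambda)\right]^2=t^2\left[(\beta_n')^2+4\beta_n^3-2(2n+\lambda)\beta_n^2+n(n+\lambda)\beta_n\right].$$ Moreover, let $t=\sqrt{2}\,z$ and define $v(z)$ by $$\beta_n(t)=\frac{2n+\lambda}{6}-\frac{v(z)}{2}.$$ Then $v(z)$ satisfies the first member of the Chazy II system (with $'=d/dz$) $$\big(v''-6v^2-\tilde{\alpha}_1\big)^2=z^2\big((v')^2-4v^3-2\tilde{\alpha}_1v-\tilde{\beta}_1\big),$$ with parameters $$\tilde{\alpha}_1=-\frac{2}{3}(n^2+n\lambda+\lambda^2),\qquad \tilde{\beta}_1=-\frac{4}{27}(2n^3+3n^2\lambda-3n\lambda^2-2\lambda^3).$$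
   Context: For $\lambda>0$ and $t\in\mathbb{R}$, let $w(x;t)=x^\lambda e^{-x^2+tx}$ for $x\in(0,\infty)$. $P_n(x;t)$ is the monic polynomial of degree $n$ in $x$ with $\int_0^\infty P_m(x;t)P_n(x;t)w(x;t)\,dx=h_n(t)\delta_{mn}$ for $m,n\ge 0$. The recurrence coefficients $\alpha_n(t),\beta_n(t)$ are defined by the three-term recurrence relation $xP_n(x;t)=P_{n+1}(x;t)+\alpha_n(t)P_n(x;t)+\beta_n(t)P_{n-1}(x;t)$ with $P_0=1$ and $\beta_0P_{-1}=0$ (convention $\beta_0=0$); for $n\ge1$, $\beta_n=h_n/h_{n-1}$. *)

(* Defs.v *)
From HB Require Import structures.
From mathcomp Require Import all_boot all_order all_algebra.
From mathcomp Require Import all_classical all_reals all_analysis.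
Import Order.TTheory GRing.Theory Num.Theory.
Import numFieldNormedType.Exports.

Set Implicit Arguments.
Unset Strict Implicit.
Unset Printing Implicit Defensive.

Local Open Scope classical_set_scope.
Local Open Scope ring_scope.

Definition weight (R : realType) (lam t x : R) : R :=
  x `^ lam * expR (- x ^+ 2 + t * x).

(* [Rintegral] is 0 for an infinite or undefined integral; for [weight] with
   [0 < lam] every integral below converges absolutely. *)
Definition monic_orthogonal (R : realType) (w : R -> R)
    (P : nat -> {poly R}) (h : nat -> R) : Prop :=
  (forall n, P n \is monic /\ size (P n) = n.+1) /\
  (forall m n,
    Rintegral (@lebesgue_measure R) `]0, +oo[
      (fun x => (P m).[x] * (P n).[x] * w x) =
    if m == n then h n else 0).

Definition recurrence_coefficients (R : realType)
    (P : nat -> {poly R}) (alpha beta : nat -> R) : Prop :=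
  beta 0%N = 0 /\
  (forall n,
    'X * P n = P n.+1 + alpha n *: P n +
               beta n *: (if n is m.+1 then P m else 0)).

(* [derive1n] is total (an arbitrary value where the limit does not exist), so
   solving a second-order equation has to include twice differentiability. *)
Definition twice_derivable (R : realType) (f : R -> R) : Prop :=
  forall x, derivable f x 1 /\ derivable (derive1 f) x 1.

(* First member of the Chazy II system, with parameters [a] and [b]. *)
Definition chazyII_first (R : realType) (a b : R) (v : R -> R) : Prop :=
  twice_derivable v /\
  (forall z,
    (derive1n 2 v z - 6 * v z ^+ 2 - a) ^+ 2 =
    z ^+ 2 * (derive1 v z ^+ 2 - 4 * v z ^+ 3 - 2 * a * v z - b)).

(* Main.v *)
Require Import Defs.
From HB Require Import structures.
From mathcomp Require Import all_boot all_order all_algebra.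
From mathcomp Require Import all_classical all_reals all_analysis.
From mathcomp Require Import measurable_realfun ring.
Import Order.TTheory GRing.Theory Num.Theory.
Import numFieldNormedType.Exports.

(** The weight satisfies two first-order linear equations, one in each variable:
    [x * d/dx w = (lam - 2 * x^2 + t * x) * w] and [d/dt w = x * w]. Integrated
    against polynomials, they say that the moment functional
    [L_t p = int_0^oo p w dx] satisfies
    [L_t ((X p)' + p * (lam - 2 X^2 + t X)) = 0] ([weighted_integral_pearson])
    and [d/dt (L_t p) = L_t (X p)] ([is_derive_weighted_integral]). Everything
    else follows algebraically from these two identities, the linearity of
    [L_t], and the fact that [h_n = L_t (P_n^2)] does not vanish.

    Write [a_n] and [b_n] for the diagonal and off-diagonal recurrence
    coefficients. For fixed [t], the first identity gives two difference equations, the string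
    equations. Applied to [P_n^2] it yields
    [2 b_{n+1} + 2 b_n + 2 a_n^2 - t a_n = 2 n + 1 + lam]
    ([first_string_equation]). Applied to [P_n P_k] it determines the expansion
    of [X P_n'] in the orthogonal basis, hence
    [X P_n' = (n - 2 b_n) P_n + b_n (2 X + 2 a_n - t) P_{n-1}]
    ([structure_relation]). At [X = 0] the left side vanishes; the relations for
    [n] and [n - 1] become a homogeneous linear system for the pair
    [(P_n(0), P_{n-1}(0))], which is not zero. The vanishing of its determinant
    is [(2 a_n - t) (2 a_{n-1} - t) b_n = (2 b_n - n) (2 b_n - n - lam)]
    ([second_string_equation]).

    The second identity makes the coefficients of [P_n] differentiable in [t] and
    yields the Toda equations [a_n' = b_{n+1} - b_n] and
    [b_n' = b_n (a_n - a_{n-1})] ([toda_alpha], [toda_beta]). Differentiating the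
    latter once more and eliminating [a_n], [a_{n-1}], [b_{n+1}], [b_{n-1}] with
    the string equations leaves an equation in [b_n] alone
    ([sigma_form_of_string_equations]); the Chazy form is an affine change of
    variables of it ([chazyII_of_sigma_form]). *)

Local Open Scope classical_set_scope.
Local Open Scope ring_scope.

(** * Integrands dominated by a decaying exponential *)

Section ExpDominated.
Set Implicit Arguments.
Unset Strict Implicit.
Context {R : realType}.
Local Notation mu := (@lebesgue_measure R).
Implicit Types (C x : R) (f F : R -> R).

Lemma continuous_expRN : continuous (fun x : R => expR (- x)).
Proof.
move=> x; apply: (@continuous_comp _ _ _ (fun y : R => - y) expR).
  exact: opp_continuous.
exact: continuous_expR.
Qed.

Lemma is_derive_expRN C x :
  is_derive x 1 (fun y => C * expR (- y)) (- (C * expR (- x))).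
Proof.
have ? : is_derive (- x) 1 expR (expR (- x)) by exact: is_derive_expR.
rewrite [X in is_derive _ _ X _](_ : _ = (cst C) * (expR \o -%R)); last first.
  by apply/funext => y; rewrite fctE.
by apply: is_derive_eq; rewrite /GRing.scale /=; ring.
Qed.

Lemma integral_expRN C : 0 <= C ->
  (\int[mu]_(x in `]0%R, +oo[) (C * expR (- x))%:E = C%:E)%E.
Proof.
move=> C0; rewrite integral_itv_obnd_cbnd; last first.
  apply/measurable_EFinP; apply: open_continuous_measurable_fun => //.
  by move=> x _; apply: cvgM; [exact: cvg_cst|exact: continuous_expRN].
rewrite (@ge0_continuous_FTC2y _ _ (fun x => - C * expR (- x)) _ 0).
- by rewrite oppr0 expR0 mulr1 -EFinB sub0r opprK.
- by move=> x _; rewrite mulr_ge0 ?expR_ge0.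
- by apply: continuous_subspaceT => x; apply: cvgM;
    [exact: cvg_cst|exact: continuous_expRN].
- by rewrite -(mulr0 (- C)); apply: cvgM; [exact: cvg_cst|exact: cvgr_expR].
- by move=> x _; have [] := is_derive_expRN (- C) x.
- apply: cvg_at_right_filter; apply: cvgM; [exact: cvg_cst|].
  exact: continuous_expRN.
- move=> x _; rewrite derive1E; have [_ ->] := is_derive_expRN (- C) x.
  by rewrite mulNr opprK.
Qed.

Lemma integrable_expRN C : 0 <= C ->
  mu.-integrable `]0, +oo[ (fun x => (C * expR (- x))%:E).
Proof.
move=> C0; apply/integrableP; split.
  apply/measurable_EFinP; apply: open_continuous_measurable_fun => //.
  by move=> x _; apply: cvgM; [exact: cvg_cst|exact: continuous_expRN].
under eq_integral do rewrite gee0_abs ?lee_fin ?mulr_ge0 ?expR_ge0//.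
by rewrite integral_expRN// ltry.
Qed.

Lemma integrable_exp_dominated f C : 0 <= C ->
  {within `[0, +oo[, continuous f} ->
  (forall x, 0 <= x -> `|f x| <= C * expR (- x)) ->
  mu.-integrable `]0, +oo[ (EFin \o f).
Proof.
move=> C0 cf fC; apply: (@le_integrable _ _ _ mu _ _ _ (fun x => (C * expR (- x))%:E)) => //.
  apply/measurable_EFinP; apply: open_continuous_measurable_fun => //.
  by have /continuous_within_itvcyP[/in_continuous_mksetP] := cf.
- move=> x; rewrite /= in_itv/= andbT => x0; rewrite lee_fin.
  by rewrite (le_trans (fC _ (ltW x0)))// ler_norm.
exact: integrable_expRN.
Qed.

(** Domination reduces an integrand of variable sign to a nonnegative one, for
    which monotone convergence suffices: add [C * expR (- x)], whose primitive
    and integral are explicit. *)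
Lemma exp_dominated_FTC2y f F C : 0 <= C ->
  {within `[0, +oo[, continuous f} ->
  (forall x, 0 <= x -> `|f x| <= C * expR (- x)) ->
  (forall x, 0 < x -> is_derive x 1 F (f x)) ->
  F x @[x --> 0^'+] --> F 0 -> F x @[x --> +oo] --> 0 ->
  Rintegral mu `]0, +oo[ f = - F 0.
Proof.
move=> C0 cf fC dF F0 Foo.
have int_f := integrable_exp_dominated C0 cf fC.
have int_e := integrable_expRN C0.
pose g x := f x + C * expR (- x).
pose G x := F x - C * expR (- x).
have ce : continuous (fun x : R => C * expR (- x)).
  by move=> x; apply: cvgM; [exact: cvg_cst|exact: continuous_expRN].
have dG x : 0 < x -> is_derive x 1 G (g x).
  move=> x0; have ? := dF x x0; have ? := is_derive_expRN C x.
  rewrite /G /g -[in f x + _](opprK (C * _)).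
  exact: is_deriveB.
have intg : Rintegral mu `]0, +oo[ g = C - F 0.
  rewrite (_ : C - F 0 = 0 - G 0); last by rewrite /G oppr0 expR0; ring.
  rewrite Rintegral_itv_obnd_cbnd; last first.
    by apply: (integrableD _ int_f int_e).
  apply: Rintegral_ge0_continuous_FTC2y.
  - move=> x x0; rewrite -lerBlDr sub0r.
    by have := fC x x0; rewrite ler_norml => /andP[].
  - have /continuous_within_itvcyP[cf1 cf2] := cf.
    apply/continuous_within_itvcyP; split=> [x x0|].
      by apply: cvgD; [exact: cf1|exact: ce].
    by apply: cvgD => //; apply: cvg_at_right_filter; exact: ce.
  - rewrite -(subrr (0 : R)) -{2}(mulr0 C); apply: cvgB => //.
    by apply: cvgM; [exact: cvg_cst|exact: cvgr_expR].
  - by move=> x x0; have [] := dG x x0.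
  - by apply: cvgB => //; apply: cvg_at_right_filter; exact: ce.
  - move=> x; rewrite in_itv/= andbT => x0; rewrite derive1E.
    by have [_ ->] := dG x x0.
have : Rintegral mu `]0, +oo[ g = Rintegral mu `]0, +oo[ f + C.
  rewrite RintegralD//; congr (_ + _).
  by rewrite /Rintegral integral_expRN.
by rewrite intg addrC => /addIr <-.
Qed.
End ExpDominated.

(** * The weight and its moment functional *)

Section WeightedIntegral.
Set Implicit Arguments.
Unset Strict Implicit.
Context {R : realType}.
Local Notation mu := (@lebesgue_measure R).
Variable lam : R.
Hypothesis lam_gt0 : 0 < lam.
Implicit Types (p q : {poly R}) (s t x : R).

Lemma weight_ge0 t x : 0 <= weight lam t x.
Proof. by rewrite mulr_ge0 ?powR_ge0 ?expR_ge0. Qed.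

Lemma weight_gt0 t x : 0 < x -> 0 < weight lam t x.
Proof. by move=> x0; rewrite mulr_gt0 ?powR_gt0 ?expR_gt0. Qed.

Lemma is_derive_weight t x : 0 < x ->
  is_derive x 1 (weight lam t) ((lam / x - 2 * x + t) * weight lam t x).
Proof.
move=> x0; have ? := is_derive1_powR lam x0.
have ? : is_derive (- x ^+ 2 + t * x) 1 expR (expR (- x ^+ 2 + t * x)).
  exact: is_derive_expR.
rewrite [X in is_derive _ _ X _](_ : _ =
    (fun y => y `^ lam) * (expR \o (fun y => - y ^+ 2 + t * y))); last first.
  by apply/funext => y; rewrite fctE.
apply: is_derive_eq.
have -> : x `^ (lam - 1) = x `^ lam / x.
  by rewrite powRB ?(gt_eqF x0) ?implybT// powRr1 // ltW.
rewrite /weight /GRing.scale /=.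
by field; rewrite gt_eqF.
Qed.

Lemma is_derive_weight_param t x :
  is_derive t 1 (fun s => weight lam s x) (x * weight lam t x).
Proof.
have ? : is_derive (- x ^+ 2 + t * x) 1 expR (expR (- x ^+ 2 + t * x)).
  exact: is_derive_expR.
have -> : (fun s => weight lam s x) =
    (cst (x `^ lam)) * (expR \o (fun s => - x ^+ 2 + s * x)).
  by apply/funext => y; rewrite fctE.
apply: is_derive_eq.
by rewrite /weight /GRing.scale /=; ring.
Qed.

Lemma horner_le_expR p :
  exists A K : R, [/\ 0 <= A, 0 <= K &
    forall x, 0 <= x -> `|p.[x]| <= A * expR (K * x)].
Proof.
elim/poly_ind: p => [|p c [A [K [A0 K0 Hp]]]].
  by exists 0, 0; split=> // x _; rewrite horner0 normr0 mul0r.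
exists (A + `|c|), (K + 1); split; rewrite ?addr_ge0// => x x0.
rewrite !hornerE mulrDl (le_trans (ler_normD _ _))// lerD//.
  rewrite normrM mulrDl mul1r expRD mulrA ler_pM// ?Hp// ger0_norm//.
  by rewrite (le_trans _ (expR_ge1Dx x))// lerDr.
rewrite ler_peMr// -expR0 ler_expR; rewrite mulr_ge0// addr_ge0//.
Qed.

(** The bound is uniform in [s <= b] because the weight increases with its
    parameter on the half-line; this uniformity is what allows differentiation
    under the integral sign. Polynomials and the power of [x] are at most
    exponential, and the Gaussian absorbs every exponential. *)
Lemma weight_dominated p b : exists2 C, 0 <= C &
  forall s x, s <= b -> 0 <= x -> `|p.[x] * weight lam s x| <= C * expR (- x).
Proof.
have [A [K [A0 K0 Hp]]] := horner_le_expR p.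
(* [c * x - x^2 <= c^2 / 4], and [c] collects all exponential rates, with 1 more
   to leave the factor [expR (- x)]. *)
pose c := K + lam + b + 1.
exists (A * expR (c ^+ 2 / 4)) => [|s x sb].
  by rewrite mulr_ge0// expR_ge0.
rewrite le_eqVlt => /predU1P[<-|x0].
  by rewrite /weight powR0 ?gt_eqF// mul0r mulr0 normr0 !mulr_ge0// expR_ge0.
rewrite normrM (ger0_norm (weight_ge0 _ _)).
have powR_le : x `^ lam <= expR (lam * x).
  rewrite /powR gt_eqF// ler_expR ler_pM2l//.
  by rewrite ltW// ln_sublinear.
apply: (@le_trans _ _ (A * expR (K * x) * (expR (lam * x) * expR (- x ^+ 2 + b * x)))).
  rewrite ler_pM// ?weight_ge0 ?Hp ?(ltW x0)// /weight ler_pM// ?powR_ge0 ?expR_ge0//.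
  by rewrite ler_expR lerD2l ler_pM2r.
rewrite -!mulrA -!expRD ler_wpM2l// ler_expR -subr_ge0.
rewrite (_ : _ - _ = (x - c / 2) ^+ 2) ?sqr_ge0// /c.
by field.
Qed.

Definition weighted_integral t p : R :=
  Rintegral mu `]0, +oo[ (fun x => p.[x] * weight lam t x).

Local Notation L := weighted_integral.

Lemma continuous_horner p : continuous (horner p).
Proof.
by move=> x; apply/differentiable_continuous/derivable1_diffP/derivable_horner.
Qed.

Lemma poly_weight_continuous p t :
  {within `[0, +oo[, continuous (fun x => p.[x] * weight lam t x)}.
Proof.
apply/continuous_within_itvcyP; split => [x|].
  rewrite in_itv/= andbT => x0; apply: cvgM; first exact: continuous_horner.
  have [d _] := is_derive_weight t x0.
  exact/differentiable_continuous/derivable1_diffP.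
apply: cvgM; first by apply: cvg_at_right_filter; exact: continuous_horner.
apply: cvgM; first by rewrite powR0 ?gt_eqF//; exact: powR_cvg0.
apply: cvg_at_right_filter.
have ? : is_derive (- 0 ^+ 2 + t * 0) 1 expR (expR (- 0 ^+ 2 + t * 0)).
  exact: is_derive_expR.
have : derivable (expR \o (fun y => - y ^+ 2 + t * y)) 0 1 by exact: ex_derive.
by move/derivable1_diffP/differentiable_continuous.
Qed.

Lemma poly_weight_integrable p t :
  mu.-integrable `]0, +oo[ (EFin \o (fun x => p.[x] * weight lam t x)).
Proof.
have [C C0 Cp] := weight_dominated p t.
apply: (integrable_exp_dominated C0); first exact: poly_weight_continuous.
by move=> x x0; exact: Cp.
Qed.

Fact weighted_integral_is_linear t : linear_for *%R (L t).
Proof.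
move=> c p q; rewrite /weighted_integral -RintegralZl//; last first.
  exact: poly_weight_integrable.
rewrite -RintegralD//; last 2 first.
- rewrite [X in integrable _ _ X](_ : _ =
      EFin \o (fun x => (c *: p).[x] * weight lam t x)).
    exact: poly_weight_integrable.
  by apply/funext => x /=; rewrite hornerZ mulrA.
- exact: poly_weight_integrable.
by apply: eq_Rintegral => x _; rewrite hornerD hornerZ; ring.
Qed.

(** The integrand is the derivative of [x * p(x) * w(x)], which vanishes at both
    ends of the half-line. *)
Lemma weighted_integral_pearson p t :
  L t (('X * p)^`() + p * (lam%:P - 2%:P * 'X^2 + t%:P * 'X)) = 0.
Proof.
set q := (X in L t X).
have [C C0 Cq] := weight_dominated q t.
have [D D0 Dp] := weight_dominated ('X * p) t.
pose F x := ('X * p).[x] * weight lam t x.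
rewrite -[RHS]oppr0 (_ : (0:R) = F 0); last by rewrite /F hornerM hornerX !mul0r.
apply: (exp_dominated_FTC2y C0).
- exact: poly_weight_continuous.
- by move=> x x0; exact: Cq.
- move=> x x0; have ? := is_derive_weight t x0.
  have ? := is_derive_poly ('X * p) x.
  rewrite [X in is_derive _ _ X _](_ : _ = (horner ('X * p)) * weight lam t); last first.
    by apply/funext => y; rewrite fctE.
  apply: is_derive_eq; rewrite /q /GRing.scale /=.
  rewrite !(hornerD, hornerN, hornerM, hornerC, hornerX, hornerXn).
  by field; rewrite gt_eqF.
- by have /continuous_within_itvcyP[_] := @poly_weight_continuous ('X * p) t.
apply: norm_cvg0; apply: (@squeeze_cvgr _ _ _ _ (cst 0) (fun x => D * expR (- x))).
- near=> x; rewrite /= normr_ge0/=; apply: Dp => //.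
- exact: cvg_cst.
- by rewrite -(mulr0 D); apply: cvgM; [exact: cvg_cst|exact: cvgr_expR].
Unshelve. all: end_near. Qed.

Lemma is_derive_weighted_integral p t :
  is_derive t 1 (fun s => L s p) (L t ('X * p)).
Proof.
have [C C0 Cp] := weight_dominated ('X * p) (t + 1).
pose f s x := p.[x] * weight lam s x.
have df s x : is_derive s 1 (f ^~ x) (('X * p).[x] * weight lam s x).
  have ? := is_derive_weight_param s x.
  rewrite [X in is_derive _ _ X _](_ : _ = cst p.[x] * (fun s => weight lam s x)); last first.
    by apply/funext => y; rewrite fctE.
  by apply: is_derive_eq; rewrite /GRing.scale /= hornerM hornerX; ring.
have d1f s x : partial1of2 f s x = ('X * p).[x] * weight lam s x.
  by rewrite partial1of2E; have [_ ->] := df s x.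
have It : `]t - 1, t + 1[%classic t by rewrite /= in_itv/= ltrBlDr !ltrDl ltr01.
have intf s : `]t - 1, t + 1[%classic s -> mu.-integrable `]0, +oo[ (EFin \o f s).
  by move=> _; exact: poly_weight_integrable.
have derf s x : `]t - 1, t + 1[%classic s -> `]0, +oo[%classic x -> derivable (f ^~ x) s 1.
  by move=> _ _; have [] := df s x.
have G0 x : 0 <= C * expR (- x) by rewrite mulr_ge0 ?expR_ge0.
have Gub s x : `]t - 1, t + 1[%classic s -> `]0, +oo[%classic x ->
    `|partial1of2 f s x| <= C * expR (- x).
  rewrite /= !in_itv/= andbT => /andP[_ st] x0.
  by rewrite d1f; apply: Cp; exact: ltW.
have mD : measurable (`]0%R, +oo[%classic : set R) by [].
split.
  exact: (@derivable_under_integral R _ _ mu f _ mD t _ _ It intf derf _ G0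
    (integrable_expRN C0) Gub).
rewrite -derive1E.
rewrite (@differentiation_under_integral R _ _ mu f _ mD t _ _ It intf derf _ G0
  (integrable_expRN C0) Gub).
by apply: eq_Rintegral => x _; rewrite d1f.
Qed.

Lemma finite_set_roots p : p != 0 -> finite_set [set x | root p x].
Proof.
have [n] := ubnP (size p); elim: n p => // n IHn p /ltnSE pn p0.
have [[a ra]|noroot] := pselect (exists a, root p a); last first.
  rewrite (_ : [set x | _] = set0); first exact: finite_set0.
  by rewrite -subset0 => x /= rx; apply: noroot; exists x.
have [q pE] := factor_theorem _ _ ra.
have q0 : q != 0 by apply: contraNneq p0 => q0; rewrite pE q0 mul0r.
apply: (@sub_finite_set _ _ ([set a] `|` [set x | root q x])).
  move=> x /=; rewrite pE rootM root_XsubC => /orP[rx|/eqP ->]; [by right|by left].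
rewrite finite_setU; split; first exact: finite_set1.
apply: IHn => //; apply: leq_trans pn.
by rewrite pE size_Mmonic ?monicXsubC// size_XsubC addn2.
Qed.

(** A null integral would make [p] vanish almost everywhere on [(0, 1)], where
    the weight is positive; but [p] has finitely many roots. *)
Lemma weighted_integral_sqr_neq0 p t : p != 0 -> L t (p * p) != 0.
Proof.
move=> p0; apply/negP => /eqP Lp0.
pose f x := (p * p).[x] * weight lam t x.
have f0 x : 0 <= f x by rewrite /f mulr_ge0 ?weight_ge0// hornerM -expr2 sqr_ge0.
have int_f : mu.-integrable `]0, +oo[ (EFin \o f).
  exact: poly_weight_integrable.
have : (\int[mu]_(x in `]0%R, +oo[) `|(EFin \o f) x| = 0)%E.
  under eq_integral do rewrite gee0_abs ?lee_fin ?f0//.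
  rewrite -[LHS]fineK; last exact: integrable_fin_num.
  by congr EFin.
move/ae_eq_integral_abs => /(_ _)[]//; first exact: measurable_int int_f.
move=> N [mN N0 fN].
have : mu.-negligible (`]0, 1[%classic : set R).
  apply: (@negligibleS _ _ _ mu (N `|` [set x | root p x])).
    move=> x /=; rewrite in_itv/= => /andP[x0 _].
    have [rx|rx] := boolP (root p x); [by right|left].
    apply: fN; apply/not_implyP; split; first by rewrite /= in_itv/= x0.
    move=> [] /eqP; rewrite mulf_eq0 hornerM mulf_eq0 -rootE (negbTE rx)/=.
    by rewrite (gt_eqF (weight_gt0 _ _)).
  apply: negligibleU; first by exists N; split.
  have cr : countable [set x | root p x].
    by apply: finite_set_countable; exact: finite_set_roots.
  exists [set x | root p x]; split => //; last exact: countable_lebesgue_measure0.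
  exact: countable_measurable.
move=> neg01; have : mu `]0%R, 1%R[ = 0%E by exact: measure_negligible neg01.
rewrite lebesgue_measure_itv/= lte_fin ltr01 => /eqP.
by rewrite oppr0 adde0 eqe oner_eq0.
Qed.

End WeightedIntegral.

(** * Orthogonal polynomials and the string equations *)

Section OrthogonalPolynomials.
Set Implicit Arguments.
Unset Strict Implicit.
Variables (F : fieldType) (L : {scalar {poly F}}).
Variables (P : nat -> {poly F}) (h a b : nat -> F).
Hypothesis P_monic : forall n, P n \is monic.
Hypothesis size_P : forall n, size (P n) = n.+1.
Hypothesis L_P : forall m n, L (P m * P n) = if m == n then h n else 0.
Hypothesis h_neq0 : forall n, h n != 0.
Hypothesis b0 : b 0%N = 0.
Hypothesis P_rec : forall n,
  'X * P n = P n.+1 + a n *: P n + b n *: (if n is m.+1 then P m else 0).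
Implicit Types (p q : {poly F}).

Lemma coef_P_lead n : (P n)`_n = 1.
Proof. by have /monicP := P_monic n; rewrite /lead_coef size_P. Qed.

Lemma size_sub_lead_coef q n : (size q <= n.+1)%N -> (size (q - q`_n *: P n)%R <= n)%N.
Proof.
move=> qn; apply/leq_sizeP => j; rewrite leq_eqVlt => /predU1P[<-|nj].
  by rewrite coefB coefZ coef_P_lead mulr1 subrr.
rewrite coefB coefZ [(P n)`_j]nth_default ?size_P// mulr0 subr0.
by rewrite nth_default// (leq_trans qn).
Qed.

Lemma pairing_low_degree q n : (size q <= n)%N -> L (q * P n) = 0.
Proof.
suff H m : (m <= n)%N -> (size q <= m)%N -> L (q * P n) = 0 by exact: H.
elim: m q => [|m IHm] q mn.
  by rewrite leqn0 size_poly_eq0 => /eqP ->; rewrite mul0r linear0.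
move=> qm; rewrite -(subrK (q`_m *: P m) q) mulrDl linearD /=.
rewrite IHm ?(ltnW mn)//; last exact: size_sub_lead_coef.
by rewrite -scalerAl linearZ/= L_P ltn_eqF// mulr0 addr0.
Qed.

Lemma pairing_lead_coef q n : (size q <= n.+1)%N -> L (q * P n) = q`_n * h n.
Proof.
move=> qn; rewrite -{1}(subrK (q`_n *: P n) q) mulrDl linearD /=.
rewrite pairing_low_degree ?add0r; last exact: size_sub_lead_coef.
by rewrite -scalerAl linearZ/= L_P eqxx.
Qed.

Lemma eq0_of_orthogonal q n : (size q <= n)%N -> (forall k, (k < n)%N -> L (q * P k) = 0) ->
  q = 0.
Proof.
elim: n q => [|n IHn] q; first by rewrite leqn0 size_poly_eq0 => /eqP.
move=> qn Lq; apply: IHn => [|k kn]; last by apply: Lq; exact: ltnW.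
have /eqP := Lq n (ltnSn n); rewrite pairing_lead_coef// mulf_eq0 (negbTE (h_neq0 n)) orbF.
by move=> /eqP qn0; have := size_sub_lead_coef qn; rewrite qn0 scale0r subr0.
Qed.

(** With [pairing_low_degree] and [pairing_lead_coef], this evaluates all the
    pairings below. *)
Lemma pairing_XP q n : L ('X * P n * q) =
  L (P n.+1 * q) + a n * L (P n * q) + b n * L ((if n is m.+1 then P m else 0) * q).
Proof. by rewrite P_rec !mulrDl -!scalerAl !linearD !linearZ. Qed.

Lemma size_XP n : size ('X * P n) = n.+2.
Proof. by rewrite mulrC size_mulX ?size_P// -size_poly_gt0 size_P. Qed.

Lemma size_deriv_XP n : (size ('X * P n)^`() <= n.+1)%N.
Proof.
have := @lt_size_deriv _ ('X * P n); rewrite size_XP ltnS; apply.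
by rewrite -size_poly_gt0 size_XP.
Qed.

Lemma coef_XP_lead n : ('X * P n)`_n.+1 = 1.
Proof. by rewrite coefXM/= coef_P_lead. Qed.

Lemma pairing_XP_next n : L ('X * P n * P n.+1) = h n.+1.
Proof. by rewrite pairing_lead_coef ?size_XP// coef_XP_lead mul1r. Qed.

(** [L (X * P n * P n.+1)] computed with [X] on either factor. *)
Lemma norm_succ n : h n.+1 = b n.+1 * h n.
Proof.
rewrite -pairing_XP_next mulrAC pairing_XP !L_P eqxx.
by rewrite !gtn_eqF// mulr0 !add0r.
Qed.

Lemma recurrence_coef_neq0 n : b n.+1 != 0.
Proof.
by apply: contraNneq (h_neq0 n.+1) => bn0; rewrite norm_succ bn0 mul0r.
Qed.

Lemma pairing_XP_same n : L ('X * P n * P n) = a n * h n.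
Proof.
rewrite pairing_XP !L_P eqxx gtn_eqF// add0r.
case: n => [|n]; first by rewrite b0 mul0r addr0.
by rewrite L_P ltn_eqF// mulr0 addr0.
Qed.

Lemma pairing_XP_prev n : b n * L ((if n is m.+1 then P m else 0) * ('X * P n)) = b n * h n.
Proof.
case: n => [|n]; first by rewrite b0 !mul0r.
by rewrite mulrCA mulrA pairing_XP_next.
Qed.

Lemma pairing_XP_XP n : L ('X * P n * ('X * P n)) = (b n.+1 + a n ^+ 2 + b n) * h n.
Proof.
rewrite pairing_XP pairing_XP_prev mulrC pairing_XP_next [P n * _]mulrC.
by rewrite pairing_XP_same norm_succ; ring.
Qed.

Variables (lam t : F).
Hypothesis pearson : forall p,
  L (('X * p)^`() + p * (lam%:P - 2%:P * 'X^2 + t%:P * 'X)) = 0.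

(** The Pearson identity for [p * q], arranged as an integration by parts: it
    moves [X d/dX] from [p] to [q]. *)
Lemma pearson_mul p q : L ('X * p^`() * q) + L (p * ('X * q)^`()) =
  2 * L ('X * p * ('X * q)) - t * L ('X * p * q) - lam * L (p * q).
Proof.
have := pearson (p * q).
rewrite (_ : _ + _ = 'X * p^`() * q + p * ('X * q)^`()
   + lam *: (p * q) - 2 *: ('X * p * ('X * q)) + t *: ('X * p * q)); last first.
  by rewrite !derivM derivX -!mul_polyC; ring.
rewrite !(linearD, linearN, linearZ)/= => e.
by rewrite -[LHS]subr0 -[X in _ - X]e; ring.
Qed.

Lemma size_XdP n : (size ('X * (P n)^`())%R <= n.+1)%N.
Proof.
have [->|d0] := eqVneq (P n)^`() 0; first by rewrite mulr0 size_poly0.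
rewrite mulrC size_mulX//.
by have := lt_size_deriv (monic_neq0 (P_monic n)); rewrite size_P.
Qed.

Lemma pairing_XdP_same n : L ('X * (P n)^`() * P n) = n%:R * h n.
Proof.
rewrite pairing_lead_coef ?size_XdP//; congr (_ * _); case: n => [|n].
  by rewrite coefXM.
by rewrite coefXM/= coef_deriv coef_P_lead.
Qed.

(** [pearson_mul] with both arguments equal to [P n]. *)
Lemma first_string_equation n :
  2 * b n.+1 + 2 * b n + 2 * a n ^+ 2 - t * a n = 2 * n%:R + 1 + lam.
Proof.
have := pearson_mul (P n) (P n).
rewrite pairing_XP_XP pairing_XP_same L_P eqxx derivM derivX mul1r mulrDr linearD/= L_P eqxx.
rewrite [P n * ('X * _)]mulrC pairing_XdP_same => e.
apply: (mulIf (h_neq0 n)); apply/eqP; rewrite -subr_eq0; apply/eqP.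
move/eqP: e; rewrite eq_sym -subr_eq0 => /eqP <-; ring.
Qed.

(** Both sides have degree at most [n], so it suffices to pair them with [P k]
    for [k <= n]. For [k < n], [pearson_mul] trades the derivative for
    [2 X^2 - t X], because [(X P k)'] has degree below [n]. *)
Lemma structure_relation m : let n := m.+1 in
  'X * (P n)^`() =
    (n%:R - 2 * b n) *: P n + b n *: ((2 *: 'X + (2 * a n - t)%:P) * P m).
Proof.
move=> n; apply/eqP; rewrite -subr_eq0; apply/eqP; set q := _ - _.
have qL k : L (q * P k) = L ('X * (P n)^`() * P k) - (n%:R - 2 * b n) * L (P n * P k)
    - b n * (2 * L ('X * P m * P k) + (2 * a n - t) * L (P m * P k)).
  rewrite (_ : q * P k = 'X * (P n)^`() * P k - (n%:R - 2 * b n) *: (P n * P k)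
     - b n *: (2 *: ('X * P m * P k) + (2 * a n - t) *: (P m * P k))).
    by rewrite !(linearD, linearN, linearZ).
  by rewrite /q -!mul_polyC; ring.
apply: (@eq0_of_orthogonal q n.+1) => [|k]; rewrite ?ltnS.
  rewrite (leq_trans (size_polyD _ _))// geq_max size_XdP size_polyN.
  rewrite (leq_trans (size_polyD _ _))// geq_max.
  rewrite !(leq_trans (size_scale_leq _ _)) ?size_P//.
  rewrite (leq_trans (size_polyMleq _ _))// size_P addnS/= -[n.+1]addn2 addnC leq_add2l.
  rewrite (leq_trans (size_polyD _ _))// geq_max.
  rewrite (leq_trans (size_scale_leq _ _)) ?size_polyX//.
  by rewrite (leq_trans (size_polyC_leq1 _)).
rewrite leq_eqVlt => /predU1P[->|kn]; rewrite qL.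
  rewrite pairing_XdP_same L_P eqxx pairing_XP_next L_P ltn_eqF//; ring.
have -> : L ('X * (P n)^`() * P k) = 2 * L ('X * P k * ('X * P n)) - t * L ('X * P k * P n).
  have Pdk : L (P n * ('X * P k)^`()) = 0.
    by rewrite mulrC pairing_low_degree// (leq_trans (size_deriv_XP k)).
  have := pearson_mul (P n) (P k); rewrite Pdk addr0 L_P gtn_eqF// mulr0 subr0 => ->.
  by congr (2 * L _ - t * L _); [rewrite mulrC | rewrite mulrAC].
have [->|km] := eqVneq k m.
  have -> : L ('X * P m * ('X * P n)) = (a n + a m) * h n.
    have e1 : L (P n.+1 * ('X * P m)) = 0 by rewrite mulrC pairing_low_degree// size_XP.
    have e2 : L (P n * ('X * P m)) = h n by rewrite mulrC pairing_XP_next.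
    have e3 : L (P m * ('X * P m)) = a m * h m by rewrite mulrC pairing_XP_same.
    by rewrite mulrC pairing_XP e1 e2 /= e3 norm_succ; ring.
  by rewrite pairing_XP_next pairing_XP_same !L_P eqxx gtn_eqF// norm_succ; ring.
have {}km : (k < m)%N by rewrite ltn_neqAle km -ltnS.
(* Only the coefficients of [X * P k] of degree [m] contribute on both sides; they
   vanish unless [k = m - 1], so no case distinction is needed. *)
have -> : L ('X * P k * ('X * P n)) = ('X * P k)`_m * h n.
  rewrite (_ : _ * _ = ('X * ('X * P k)) * P n); last ring.
  by rewrite pairing_lead_coef ?coefXM// mulrC size_mulX ?size_XP// -size_poly_gt0 size_XP.
have -> : L ('X * P k * P n) = 0 by rewrite pairing_low_degree// size_XP.
have -> : L ('X * P m * P k) = ('X * P k)`_m * h m.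
  by rewrite mulrAC pairing_lead_coef// size_XP.
by rewrite !L_P !gtn_eqF// norm_succ; ring.
Qed.

(** The recurrence propagates a common zero of two consecutive polynomials down
    to [P 0 = 1]. *)
Lemma horner0_consecutive n : ((P n.+1).[0] != 0) || ((P n).[0] != 0).
Proof.
elim: n => [|n IHn].
  have P0 : P 0%N = 1.
    by have := coef_P_lead 0; rewrite [P 0%N]size1_polyC ?size_P// coefC/= => ->.
  by rewrite P0 hornerC oner_eq0 orbT.
rewrite -negb_and; apply: contraTN IHn => /andP[/eqP p2 /eqP p1].
have := congr1 (horner^~ 0) (P_rec n.+1); rewrite !(hornerD, hornerM, hornerX, hornerZ) p2 p1.
rewrite mul0r mulr0 !add0r => /esym/eqP.
rewrite mulf_eq0 (negbTE (recurrence_coef_neq0 n))/= => ->.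
by rewrite eqxx.
Qed.

(** The structure relation at 0, for [n] and for [m], is a linear system for the
    nonzero vector [((P n).[0], (P m).[0])]; the equation is the vanishing of its
    determinant. *)
Lemma second_string_equation m : let n := m.+1 in
  (2 * a n - t) * (2 * a m - t) * b n =
  (2 * b n - n%:R) * (2 * b n - n%:R - lam).
Proof.
move=> n.
have E1 : (2 * b n - n%:R) * (P n).[0] = b n * (2 * a n - t) * (P m).[0].
  have := congr1 (horner^~ 0) (structure_relation m).
  rewrite !(hornerD, hornerM, hornerX, hornerZ, hornerC) mul0r => e.
  rewrite -[LHS]addr0 [X in _ + X]e -/n; ring.
(* The relation for [m], with [P_(m-1)] eliminated by the recurrence and [b m] by
   the first string equation. *)
have E2 : (2 * a m - t) * (P n).[0] = (2 * b n - n%:R - lam) * (P m).[0].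
  have fs := first_string_equation m; have := congr1 (horner^~ 0) (P_rec m).
  rewrite !(hornerD, hornerM, hornerX, hornerZ) mul0r -/n => rec0.
  have bs : (2 * a m - t) * (P n).[0]
      + ((2 * a m - t) * a m - m%:R + 2 * b m) * (P m).[0] = 0.
    rewrite -[LHS]subr0 -[X in _ - X](mulr0 (2 * a m - t)).
    rewrite [X in _ - _ * X]rec0 {rec0 fs}.
    clear E1; rewrite {}/n; case: m => [|k].
      by rewrite horner0 b0; ring.
    have := congr1 (horner^~ 0) (structure_relation k).
    rewrite !(hornerD, hornerM, hornerX, hornerZ, hornerC) mul0r => e.
    by rewrite -[RHS]oppr0 [X in _ = - X]e /=; ring.
  move: bs fs; rewrite /n -[in X in _ -> _ -> X]natr1 => bs fs.
  rewrite -[LHS]subr0 -[X in _ - X]bs.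
  transitivity ((m%:R - 2 * b m - (2 * a m - t) * a m) * (P m).[0]); first by ring.
  congr (_ * _).
  transitivity (2 * b m.+1 - m%:R - 1 - lam
    + (2 * m%:R + 1 + lam - (2 * b m.+1 + 2 * b m + 2 * a m ^+ 2 - t * a m))); first by ring.
  by rewrite fs; ring.
apply/eqP; rewrite -subr_eq0; set d := _ - _.
have dn : d * (P n).[0] = 0.
  transitivity ((2 * a n - t) * b n * ((2 * a m - t) * (P n).[0])
    - (2 * b n - n%:R - lam) * ((2 * b n - n%:R) * (P n).[0])).
    by rewrite /d; ring.
  by rewrite E1 E2; ring.
have dm : d * (P m).[0] = 0.
  transitivity ((2 * a m - t) * (b n * (2 * a n - t) * (P m).[0])
    - (2 * b n - n%:R) * ((2 * b n - n%:R - lam) * (P m).[0])).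
    by rewrite /d; ring.
  by rewrite -E1 -E2; ring.
have := horner0_consecutive m; rewrite -/n => /orP[] p0.
  by move/eqP: dn; rewrite mulf_eq0 (negbTE p0) orbF.
by move/eqP: dm; rewrite mulf_eq0 (negbTE p0) orbF.
Qed.

End OrthogonalPolynomials.

(** * Differentiable families of polynomials *)

Section RealDerivative.
Set Implicit Arguments.
Unset Strict Implicit.
Context {R : realType}.
Implicit Types (f g : R -> R) (t df dg : R).

Lemma is_derive_mul f g df dg t : is_derive t 1 f df -> is_derive t 1 g dg ->
  is_derive t 1 (fun s => f s * g s) (df * g t + f t * dg).
Proof.
move=> Hf Hg; rewrite [X in is_derive _ _ X _](_ : _ = f * g)//.
by apply: is_derive_eq; rewrite /GRing.scale/= addrC [g t * _]mulrC.
Qed.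

Lemma is_derive_sub f g df dg t : is_derive t 1 f df -> is_derive t 1 g dg ->
  is_derive t 1 (fun s => f s - g s) (df - dg).
Proof. by move=> Hf Hg; exact: is_deriveB. Qed.

Lemma is_derive_div f g df dg t : g t != 0 ->
  is_derive t 1 f df -> is_derive t 1 g dg ->
  is_derive t 1 (fun s => f s / g s) ((df - f t / g t * dg) / g t).
Proof.
move=> g0 Hf Hg; have dV := is_deriveV g0 Hg.
by apply: is_derive_eq (is_derive_mul Hf dV) _; rewrite /GRing.scale/=; field.
Qed.

Lemma is_derive_bigsum N (f : 'I_N -> R -> R) (df : 'I_N -> R) t :
  (forall i, is_derive t 1 (f i) (df i)) ->
  is_derive t 1 (fun s => \sum_(i < N) f i s) (\sum_(i < N) df i).
Proof.
move=> Hf; have := is_derive_sum Hf.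
rewrite (_ : \sum_(i < N) f i = fun s => \sum_(i < N) f i s)//.
by apply/funext => s; rewrite fct_sumE.
Qed.

End RealDerivative.

Section PolynomialFamilies.
Set Implicit Arguments.
Unset Strict Implicit.
Context {R : realType}.
Implicit Types (p q : R -> {poly R}) (dp dq : {poly R}) (c : R -> R) (t dc : R).

(** For families of bounded degree, differentiating coefficient by coefficient is
    differentiating in a finite-dimensional space, without choosing a norm. *)
Definition is_coef_derive p t (dp : {poly R}) : Prop :=
  forall i, is_derive t 1 (fun s => (p s)`_i) dp`_i.

Lemma is_coef_derive_cst (r : {poly R}) t : is_coef_derive (fun=> r) t 0.
Proof. by move=> i; rewrite coef0; exact: is_derive_cst. Qed.

Lemma is_coef_deriveB p q dp dq t : is_coef_derive p t dp -> is_coef_derive q t dq ->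
  is_coef_derive (fun s => p s - q s) t (dp - dq).
Proof.
move=> Hp Hq i; rewrite coefB; under eq_fun do rewrite coefB.
exact: is_derive_sub.
Qed.

Lemma is_coef_deriveZ c dc p dp t : is_derive t 1 c dc -> is_coef_derive p t dp ->
  is_coef_derive (fun s => c s *: p s) t (dc *: p t + c t *: dp).
Proof.
move=> Hc Hp i; rewrite coefD !coefZ; under eq_fun do rewrite coefZ.
exact: is_derive_mul.
Qed.

Lemma is_coef_deriveM p q dp dq t : is_coef_derive p t dp -> is_coef_derive q t dq ->
  is_coef_derive (fun s => p s * q s) t (dp * q t + p t * dq).
Proof.
move=> Hp Hq i; rewrite coefD !coefM -big_split/=; under eq_fun do rewrite coefM.
by apply: is_derive_bigsum => j; exact: is_derive_mul.
Qed.

Lemma size_is_coef_derive N p dp t : (forall s, (size (p s) <= N)%N) ->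
  is_coef_derive p t dp -> (size dp <= N)%N.
Proof.
move=> pN Hp; apply/leq_sizeP => i Ni; have [_ <-] := Hp i.
rewrite (_ : (fun s => (p s)`_i) = cst 0) ?derive_cst//.
by apply/funext => s; rewrite nth_default// (leq_trans (pN s)).
Qed.

Variable lam : R.
Hypothesis lam_gt0 : 0 < lam.
Local Notation L := (weighted_integral lam).

Definition weighted_functional t : {scalar {poly R}} :=
  HB.pack (L t) (GRing.isLinear.Build _ _ _ _ (L t)
    (weighted_integral_is_linear lam_gt0 t)).

Arguments weighted_functional : simpl never.

Lemma poly_sum_monomials N (r : {poly R}) : (size r <= N)%N ->
  r = \sum_(i < N) r`_i *: 'X^i.
Proof.
move=> rN; rewrite -(@poly_def _ N (fun i => r`_i)); apply/polyP => i.
by rewrite coef_poly; case: ltnP => // Ni; rewrite nth_default// (leq_trans rN).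
Qed.

Lemma weighted_integral_coef N (r : {poly R}) t : (size r <= N)%N ->
  L t r = \sum_(i < N) r`_i * L t 'X^i.
Proof.
move=> rN; rewrite {1}(poly_sum_monomials rN) -[LHS]/(weighted_functional t _).
rewrite linear_sum.
by apply: eq_bigr => i _; rewrite linearZ.
Qed.

(** A product rule: the weight contributes the factor [X], and the polynomial its
    own derivative. The degree bound makes both sides finite sums of moments. *)
Lemma is_derive_weighted_family N p dp t : (forall s, (size (p s) <= N)%N) ->
  is_coef_derive p t dp ->
  is_derive t 1 (fun s => L s (p s)) (L t ('X * p t) + L t dp).
Proof.
move=> pN Hp; have dpN := size_is_coef_derive pN Hp.
under eq_fun => s do rewrite (weighted_integral_coef _ (pN s)).
apply: is_derive_eq.
  by apply: is_derive_bigsum => i; apply: is_derive_mul; [exact: Hp|];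
    exact: is_derive_weighted_integral.
rewrite big_split/= -weighted_integral_coef// addrC; congr (_ + _).
rewrite [in RHS](poly_sum_monomials (pN t)) mulr_sumr.
rewrite -[RHS]/(weighted_functional t _) linear_sum.
by apply: eq_bigr => i _; rewrite -scalerAr linearZ.
Qed.

End PolynomialFamilies.

(** * The Toda equations *)

Section Toda.
Set Implicit Arguments.
Unset Strict Implicit.
Context {R : realType}.
Variable lam : R.
Hypothesis lam_gt0 : 0 < lam.
Variables (P : nat -> R -> {poly R}) (h alpha beta : nat -> R -> R).
Hypothesis P_orth : forall t : R,
  monic_orthogonal (weight lam t) (fun n => P n t) (fun n => h n t).
Hypothesis P_rec : forall t : R,
  recurrence_coefficients (fun n => P n t) (fun n => alpha n t) (fun n => beta n t).
Implicit Types (t : R).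
Local Notation L := (weighted_integral lam).
Local Notation Lf := (weighted_functional lam_gt0).
Local Notation Ppred n t := (if n is m.+1 then P m t else 0).

Let monicP t n : P n t \is monic.
Proof. by have [/(_ n)[]] := P_orth t. Qed.

Let sizeP t n : size (P n t) = n.+1.
Proof. by have [/(_ n)[]] := P_orth t. Qed.

Let LP t m n : Lf t (P m t * P n t) = if m == n then h n t else 0.
Proof.
have [_ <-] := P_orth t; apply: eq_Rintegral => x _; by rewrite hornerM.
Qed.

Let h_neq0 t n : h n t != 0.
Proof.
have := LP t n n; rewrite eqxx => <-.
by rewrite weighted_integral_sqr_neq0// monic_neq0.
Qed.

Let beta0 t : beta 0%N t = 0.
Proof. by have [] := P_rec t. Qed.

Let recP t n :
  'X * P n t = P n.+1 t + alpha n t *: P n t + beta n t *: Ppred n t.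
Proof. by have [_ ->] := P_rec t. Qed.

Let pearsonP t (p : {poly R}) :
  Lf t (('X * p)^`() + p * (lam%:P - 2%:P * 'X^2 + t%:P * 'X)) = 0.
Proof. exact: weighted_integral_pearson. Qed.

Lemma first_string_equation_at n t :
  2 * beta n.+1 t + 2 * beta n t + 2 * alpha n t ^+ 2 - t * alpha n t =
  2 * n%:R + 1 + lam.
Proof.
exact: (first_string_equation (monicP t) (sizeP t) (LP t) (h_neq0 t)
  (beta0 t) (recP t) (pearsonP t)).
Qed.

Lemma second_string_equation_at m t : let n := m.+1 in
  (2 * alpha n t - t) * (2 * alpha m t - t) * beta n t =
  (2 * beta n t - n%:R) * (2 * beta n t - n%:R - lam).
Proof.
exact: (second_string_equation (monicP t) (sizeP t) (LP t) (h_neq0 t)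
  (beta0 t) (recP t) (pearsonP t)).
Qed.

(** The leading coefficient is constant. Consequently [P n] is orthogonal to its
    own derivative in [t]. *)
Lemma size_derivative_P n t d : is_coef_derive (P n) t d -> (size d <= n)%N.
Proof.
move=> Pd; have := size_is_coef_derive (fun s => eq_leq (sizeP s n)) Pd.
rewrite leq_eqVlt ltnS => /predU1P[dn|//].
have d0 : d`_n = 0.
  have [_ <-] := Pd n; rewrite (_ : (fun s => _) = cst 1) ?derive_cst//.
  by apply/funext => s; exact: (coef_P_lead (monicP s) (sizeP s)).
suff d00 : d = 0 by rewrite d00 size_poly0.
by apply/eqP; rewrite -lead_coef_eq0 /lead_coef dn d0.
Qed.

(* [Lf t] is [L t] bundled with its linearity. *)
Let LfE t (p : {poly R}) : L t p = Lf t p. Proof. by []. Qed.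

Let L_lowP t (q : {poly R}) n : (size q <= n)%N -> Lf t (q * P n t) = 0.
Proof. exact: (pairing_low_degree (monicP t) (sizeP t) (LP t)). Qed.

Let L_XPPP t n : Lf t ('X * P n t * P n t) = alpha n t * h n t.
Proof. exact: (pairing_XP_same (LP t) (beta0 t) (recP t)). Qed.

Let L_recP t (q : {poly R}) n : Lf t ('X * P n t * q) =
  Lf t (P n.+1 t * q) + alpha n t * Lf t (P n t * q) + beta n t * Lf t (Ppred n t * q).
Proof. exact: (pairing_XP (Lf t) (recP t)). Qed.

Let L_XPSP t n : Lf t ('X * P n t * P n.+1 t) = h n.+1 t.
Proof. exact: (pairing_XP_next (monicP t) (sizeP t) (LP t)). Qed.

Let L_XPXPP t n : Lf t ('X * P n t * ('X * P n t)) =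
  (beta n.+1 t + alpha n t ^+ 2 + beta n t) * h n t.
Proof. exact: (pairing_XP_XP (monicP t) (sizeP t) (LP t) (beta0 t) (recP t)). Qed.

Let h_succ t n : h n.+1 t = beta n.+1 t * h n t.
Proof. exact: (norm_succ (monicP t) (sizeP t) (LP t) (recP t)). Qed.

Let size_PP n m s : (size (P n s * P m s)%R <= n.+1 + m)%N.
Proof. by rewrite (leq_trans (size_polyMleq _ _))// !sizeP addnS. Qed.

Let size_XPP n s : (size ('X * P n s * P n s)%R <= n.+2 + n)%N.
Proof.
by rewrite (leq_trans (size_polyMleq _ _))// (size_XP (sizeP s)) sizeP addnS.
Qed.

Lemma is_derive_norm n t d : is_coef_derive (P n) t d ->
  is_derive t 1 (h n) (alpha n t * h n t).
Proof.
move=> Pd; have dn := size_derivative_P Pd.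
rewrite (_ : h n = fun s => L s (P n s * P n s)); last first.
  by apply/funext => s; have := LP s n n; rewrite eqxx => <-.
apply: is_derive_eq (is_derive_weighted_family lam_gt0 (size_PP n n) (is_coef_deriveM Pd Pd)) _.
rewrite !LfE mulrA L_XPPP linearD [P n t * d]mulrC (L_lowP _ dn) !addr0.
by rewrite LP eqxx.
Qed.

Lemma alphaE n : alpha n = fun s => L s ('X * P n s * P n s) / h n s.
Proof. by apply/funext => s; rewrite LfE L_XPPP mulfK. Qed.

Lemma betaE n : beta n.+1 = fun s => h n.+1 s / h n s.
Proof.
by apply/funext => s; rewrite h_succ mulfK.
Qed.

Lemma is_derive_moment_XPP n t d : is_coef_derive (P n) t d ->
  is_derive t 1 (fun s => L s ('X * P n s * P n s))
   ((beta n.+1 t + alpha n t ^+ 2 + beta n t) * h n t + 2 * (beta n t * L t (Ppred n t * d))).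
Proof.
move=> Pd; have dn := size_derivative_P Pd.
have XPd := is_coef_deriveM (is_coef_derive_cst 'X t) Pd.
apply: is_derive_eq (is_derive_weighted_family lam_gt0 (size_XPP n) (is_coef_deriveM XPd Pd)) _.
rewrite !LfE; congr (_ + _).
  by rewrite -L_XPXPP; congr (Lf t _); ring.
rewrite (_ : _ + _ = 2 *: ('X * P n t * d)); last by rewrite -mul_polyC; ring.
rewrite linearZ/= !LfE L_recP.
by rewrite [P n.+1 t * d]mulrC [P n t * d]mulrC !L_lowP// ?mulr0 ?add0r// ltnW.
Qed.

(** Differentiate [L (P n * P (n - 1)) = 0]. *)
Lemma pairing_pred_derivative n t d : is_coef_derive (P n) t d ->
  (exists e, is_coef_derive (fun s => Ppred n s) t e) ->
  beta n t * L t (Ppred n t * d) = - (beta n t * h n t).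
Proof.
case: n => [|n] Pd [e Pe]; first by rewrite beta0 !mul0r oppr0.
rewrite -mulrN; congr (_ * _).
have := is_derive_weighted_family lam_gt0 (size_PP n.+1 n) (is_coef_deriveM Pd Pe).
rewrite (_ : (fun s => _) = cst 0); last first.
  by apply/funext => s; rewrite LfE LP gtn_eqF.
case=> _; rewrite derive_cst => /esym/eqP.
have ePS : Lf t (e * P n.+1 t) = 0.
  by apply: L_lowP; rewrite (leq_trans (size_derivative_P Pe)).
rewrite !LfE mulrA linearD/= !LfE [P n.+1 t * e]mulrC ePS addr0.
by rewrite mulrAC L_XPSP addrC [P n t * d]mulrC addr_eq0 => /eqP.
Qed.

Lemma derivable_beta n t d e : is_coef_derive (P n) t d ->
  is_coef_derive (fun s => Ppred n s) t e -> exists b, is_derive t 1 (beta n) b.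
Proof.
case: n => [|n] Pd Pe.
  exists 0; rewrite (_ : beta 0%N = cst 0); first exact: is_derive_cst.
  by apply/funext => s; rewrite beta0.
by eexists; rewrite betaE; apply: is_derive_div;
  [exact: h_neq0|exact: is_derive_norm Pd|exact: is_derive_norm Pe].
Qed.

(** The recurrence needs two consecutive polynomials, so both go through the
    induction; the recurrence coefficients are quotients of integrals of
    polynomials already known to be differentiable. *)
Lemma coef_derivable_P n t :
  (exists d, is_coef_derive (P n) t d) /\
  (exists e, is_coef_derive (fun s => Ppred n s) t e).
Proof.
elim: n => [|n [[d Pd] [e Pe]]]; split.
- exists 0; rewrite (_ : P 0%N = fun=> 1); first exact: is_coef_derive_cst.
  apply/funext => s; have := coef_P_lead (monicP s) (sizeP s) 0.
  by rewrite [P 0%N s]size1_polyC ?sizeP// coefC/= => ->.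
- by exists 0; exact: is_coef_derive_cst.
- have [a' da] : exists a', is_derive t 1 (alpha n) a'.
    by eexists; rewrite alphaE; apply: is_derive_div;
      [exact: h_neq0|exact: is_derive_moment_XPP Pd|exact: is_derive_norm Pd].
  have [b' db] : exists b', is_derive t 1 (beta n) b'.
    exact: derivable_beta Pd Pe.
  rewrite (_ : P n.+1 = fun s => 'X * P n s - alpha n s *: P n s - beta n s *: Ppred n s).
    eexists; apply: is_coef_deriveB; last exact: is_coef_deriveZ db Pe.
    apply: is_coef_deriveB; last exact: is_coef_deriveZ da Pd.
    exact: is_coef_deriveM (is_coef_derive_cst 'X t) Pd.
  by apply/funext => s; rewrite -addrA -opprD recP -(addrA (P n.+1 s)) addrK.
- by exists d.
Qed.

Lemma toda_alpha n t : is_derive t 1 (alpha n) (beta n.+1 t - beta n t).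
Proof.
have [[d Pd] Pe] := coef_derivable_P n t.
rewrite [X in is_derive _ _ X _]alphaE.
have dh := is_derive_norm Pd.
apply: is_derive_eq (is_derive_div (h_neq0 t n) (is_derive_moment_XPP Pd) dh) _.
rewrite (pairing_pred_derivative Pd Pe) LfE L_XPPP; field; exact: h_neq0.
Qed.

Lemma toda_beta n t : is_derive t 1 (beta n.+1)
  (beta n.+1 t * (alpha n.+1 t - alpha n t)).
Proof.
have [[d Pd] [e Pe]] := coef_derivable_P n.+1 t.
rewrite [X in is_derive _ _ X _]betaE.
apply: is_derive_eq (is_derive_div (h_neq0 t n) (is_derive_norm Pd) (is_derive_norm Pe)) _.
by rewrite h_succ; field; exact: h_neq0.
Qed.

End Toda.

(** * From the Toda flow to the second-order equations *)

Section SecondOrder.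
Set Implicit Arguments.
Unset Strict Implicit.
Context {R : realType}.
Implicit Types (f g k : R -> R) (t z : R).

(** The elimination behind the differential equation. Here [b], [bS], [bm] are
    the values of the off-diagonal coefficient at [n], [n + 1], [n - 1], and
    [x], [y] those of the diagonal one at [n], [n - 1]; by the Toda equations
    [b * (x - y)] is the first derivative of [b], and the first summand on the
    left is twice the second derivative. The string equations remove [bS] and [bm]
    and reduce the bracket to [- t * b * (x + y - t)]. Its square is expressed
    through the first derivative because, with [X = 2 * x - t] and
    [Y = 2 * y - t], one has [(X + Y)^2 = (X - Y)^2 + 4 * X * Y], and the second
    string equation gives [X * Y * b]. *)
Lemma sigma_form_of_string_equations (N lam t bS b bm x y : R) :
  2 * bS + 2 * b + 2 * x ^+ 2 - t * x = 2 * N + 1 + lam ->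
  2 * b + 2 * bm + 2 * y ^+ 2 - t * y = 2 * (N - 1) + 1 + lam ->
  (2 * x - t) * (2 * y - t) * b = (2 * b - N) * (2 * b - N - lam) ->
  (2 * (b * (x - y) * (x - y) + b * ((bS - b) - (b - bm))) + 12 * b ^+ 2
     - 4 * (2 * N + lam) * b + N * (N + lam)) ^+ 2 =
  t ^+ 2 * ((b * (x - y)) ^+ 2 + 4 * b ^+ 3 - 2 * (2 * N + lam) * b ^+ 2
     + N * (N + lam) * b).
Proof.
move=> s1n s1m s2.
have bSE : bS = (2 * N + 1 + lam - 2 * b - 2 * x ^+ 2 + t * x) / 2.
  by rewrite -s1n; field.
have bmE : bm = (2 * (N - 1) + 1 + lam - 2 * b - 2 * y ^+ 2 + t * y) / 2.
  by rewrite -s1m; field.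
have bs2 : b * (4 * b ^+ 2 - 2 * (2 * N + lam) * b + N * (N + lam)) =
    b * ((2 * x - t) * (2 * y - t) * b) by rewrite s2; ring.
have -> : 2 * (b * (x - y) * (x - y) + b * ((bS - b) - (b - bm))) + 12 * b ^+ 2
    - 4 * (2 * N + lam) * b + N * (N + lam) = - t * b * (x + y - t).
  transitivity (- t * b * (x + y - t) +
    ((2 * b - N) * (2 * b - N - lam) - (2 * x - t) * (2 * y - t) * b)).
    by rewrite bSE bmE; field.
  by rewrite s2 subrr addr0.
transitivity (t ^+ 2 * ((b * (x - y)) ^+ 2 +
  b * (4 * b ^+ 2 - 2 * (2 * N + lam) * b + N * (N + lam)))); last by ring.
by rewrite bs2; ring.
Qed.

Lemma twice_derivable_intro f g k : (forall t, is_derive t 1 f (g t)) ->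
  (forall t, is_derive t 1 g (k t)) ->
  [/\ twice_derivable f, derive1 f = g & derive1n 2 f = k].
Proof.
move=> fg gk.
have f1 : derive1 f = g by apply/funext => t; rewrite derive1E; have [_ ->] := fg t.
have g1 : derive1 g = k by apply/funext => t; rewrite derive1E; have [_ ->] := gk t.
by split; rewrite /= ?f1// => t; split; rewrite ?f1; [have [] := fg t|have [] := gk t].
Qed.

Lemma is_derive_affine_dilation f (df A B c z : R) : is_derive (c * z) 1 f df ->
  is_derive z 1 (fun x => A + B * f (c * x)) (B * c * df).
Proof.
move=> Hf.
rewrite [X in is_derive _ _ X _](_ : _ = cst A + cst B * (f \o (fun x => c * x)))//.
by apply: is_derive_eq; rewrite /GRing.scale/=; ring.
Qed.

(** An affine change of the unknown and a dilation of the variable by [sqrt 2];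
    the cubic right-hand side is depressed by the shift [(2 * n + lam) / 6]. *)
Lemma chazyII_of_sigma_form (n lam : R) f g k (v : R -> R) :
  (forall t, is_derive t 1 f (g t)) -> (forall t, is_derive t 1 g (k t)) ->
  (forall t, (2 * k t + 12 * f t ^+ 2 - 4 * (2 * n + lam) * f t + n * (n + lam)) ^+ 2 =
     t ^+ 2 * (g t ^+ 2 + 4 * f t ^+ 3 - 2 * (2 * n + lam) * f t ^+ 2
       + n * (n + lam) * f t)) ->
  (forall z, f (Num.sqrt 2 * z) = (2 * n + lam) / 6 - v z / 2) ->
  chazyII_first (- (2 / 3) * (n ^+ 2 + n * lam + lam ^+ 2))
    (- (4 / 27) * (2 * n ^+ 3 + 3 * n ^+ 2 * lam - 3 * n * lam ^+ 2 - 2 * lam ^+ 3)) v.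
Proof.
move=> fg gk ode fv; set c := Num.sqrt 2 in fv.
have c2 : c ^+ 2 = 2 by rewrite sqr_sqrtr.
have vE : v = fun z => (2 * n + lam) / 3 + -2 * f (c * z).
  by apply/funext => z; rewrite fv; field.
have v1 z : is_derive z 1 v (0 + - 2 * c * g (c * z)).
  by rewrite vE add0r; exact: is_derive_affine_dilation.
have v2 z : is_derive z 1 (fun z => 0 + - 2 * c * g (c * z)) (- 2 * c * c * k (c * z)).
  exact: is_derive_affine_dilation.
have [v12 dv ddv] := twice_derivable_intro v1 v2.
split=> // z; rewrite dv ddv vE.
have ck : - 2 * c * c * k (c * z) = - 4 * k (c * z).
  by transitivity (- 2 * c ^+ 2 * k (c * z)); [ring|rewrite c2; ring].
have cg : (0 + - 2 * c * g (c * z)) ^+ 2 = 8 * g (c * z) ^+ 2.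
  by rewrite add0r !exprMn c2; ring.
rewrite ck cg.
(* The Chazy bracket is [- 2] times the bracket of the hypothesis. *)
have := ode (c * z); rewrite exprMn c2; move: (f _) (g _) (k _) => b b1 b2 e.
transitivity (4 * (2 * b2 + 12 * b ^+ 2 - 4 * (2 * n + lam) * b + n * (n + lam)) ^+ 2).
  by field.
by rewrite e; field.
Qed.

End SecondOrder.

Theorem theorem1p4 (R : realType) (lam : R) (lam_gt0 : 0 < lam)
    (P : nat -> R -> {poly R}) (h alpha beta : nat -> R -> R)
    (P_orth : forall t : R,
      monic_orthogonal (weight lam t) (fun n => P n t) (fun n => h n t))
    (P_rec : forall t : R,
      recurrence_coefficients (fun n => P n t)
        (fun n => alpha n t) (fun n => beta n t))
    (n : nat) :
  (twice_derivable (beta n) /\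
   forall t : R,
     (2 * derive1n 2 (beta n) t + 12 * beta n t ^+ 2
        - 4 * (2 * n%:R + lam) * beta n t + n%:R * (n%:R + lam)) ^+ 2 =
     t ^+ 2 * (derive1 (beta n) t ^+ 2 + 4 * beta n t ^+ 3
        - 2 * (2 * n%:R + lam) * beta n t ^+ 2
        + n%:R * (n%:R + lam) * beta n t)) /\
  (forall v : R -> R,
     (forall z : R,
        beta n (Num.sqrt 2 * z) = (2 * n%:R + lam) / 6 - v z / 2) ->
     chazyII_first
       (- (2 / 3) * (n%:R ^+ 2 + n%:R * lam + lam ^+ 2))
       (- (4 / 27) * (2 * n%:R ^+ 3 + 3 * n%:R ^+ 2 * lam
                      - 3 * n%:R * lam ^+ 2 - 2 * lam ^+ 3))
       v).
Proof.
suff [g [k [bg gk ode]]] : exists g k : R -> R,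
  [/\ forall t : R, is_derive t 1 (beta n) (g t),
    forall t : R, is_derive t 1 g (k t) &
    forall t : R, (2 * k t + 12 * beta n t ^+ 2
        - 4 * (2 * n%:R + lam) * beta n t + n%:R * (n%:R + lam)) ^+ 2 =
     t ^+ 2 * (g t ^+ 2 + 4 * beta n t ^+ 3
        - 2 * (2 * n%:R + lam) * beta n t ^+ 2
        + n%:R * (n%:R + lam) * beta n t)].
  split=> [|v]; last exact: chazyII_of_sigma_form bg gk ode.
  by have [? -> ->] := twice_derivable_intro bg gk.
(* For [n = 0] the coefficient is identically 0 by convention, and there is no
   predecessor [a_{n-1}] to enter the Toda equations. *)
case: n => [|m].
  have -> : beta 0%N = cst 0 by apply/funext => t; have [] := P_rec t.
  exists (cst 0), (cst 0).
  by split=> t; [exact: is_derive_cst|exact: is_derive_cst|rewrite /cst; ring].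
set n := m.+1.
have b1 t := toda_beta lam_gt0 P_orth P_rec m t.
have a1 j t := toda_alpha lam_gt0 P_orth P_rec j t.
exists (fun t => beta n t * (alpha n t - alpha m t)).
exists (fun t => beta n t * (alpha n t - alpha m t) * (alpha n t - alpha m t)
  + beta n t * ((beta n.+1 t - beta n t) - (beta n t - beta m t))).
split=> [t|t|t]; first exact: b1.
  exact: is_derive_mul (b1 t) (is_derive_sub (a1 n t) (a1 m t)).
apply: (sigma_form_of_string_equations (bS := beta n.+1 t) (bm := beta m t)).
- by have := first_string_equation_at lam_gt0 P_orth P_rec n t.
- have -> : n%:R - 1 = m%:R :> R by rewrite /n -natr1 addrK.
  by have := first_string_equation_at lam_gt0 P_orth P_rec m t.
- by have := second_string_equation_at lam_gt0 P_orth P_rec m t.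
Qed.
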